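(* Let $\mathcal{P}=\langle \Sigma \mid \mathcal{R}\rangle$ be a semigroup presentation and $w_0\in\Sigma^+$ a base word. Then the following assertions are equivalent: (i) the Squier complex $S(\mathcal{P},w_0)$ is clean (i.e. all its hyperplanes are clean); (ii) $S(\mathcal{P},w_0)$ has no self-intersecting hyperplanes; (iii) there are no words $a,b,p\in\Sigma^+$ such that $w_0=ab$, $a=ap$ and $b=pb$ modulo $\mathcal{P}$ with $[p]_{\mathcal{P}}\neq\{p\}$. Moreover, $S(\mathcal{P},w_0)$ is special if and only if it satisfies the conditions above and the following one: (iv) there are no words $u,v,w,p,q\in\Sigma^+$ and no (possibly empty) words $a,b,\xi\in\Sigma^*$ such that $w_0=auvwb$, $au=au(v\xi)$, $wb=(\xi v)wb$ modulo $\mathcal{P}$ and such that $uv=p$ and $vw=q$ are relations of $\mathcal{R}$ (each up to exchanging its two sides).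
   Context: A semigroup presentation $\mathcal{P}=\langle\Sigma\mid\mathcal{R}\rangle$ consists of an alphabet $\Sigma$ and a set $\mathcal{R}$ of relations $u=v$ with $u,v\in\Sigma^+$. Here $\Sigma^+$ is the free semigroup of non-empty words and $\Sigma^*=\Sigma^+\cup\{1\}$ also contains the empty word $1$. Convention: if $u=v\in\mathcal{R}$ then $v=u\notin\mathcal{R}$ (in particular $u=u\notin\mathcal{R}$). Two words are equal modulo $\mathcal{P}$ if one can be transformed into the other by finitely many replacements of a subword $u$ by $v$ or $v$ by $u$, with $u=v\in\mathcal{R}$; $[p]_{\mathcal{P}}$ is the set of words equal to $p$ modulo $\mathcal{P}$. The Squier complex $S(\mathcal{P})$ is the cube complex whose vertices are the words over $\Sigma$; whose oriented edges are $(a,u\to v,b)$ with $a,b\in\Sigma^*$ and $u=v$ or $v=u$ in $\mathcal{R}$, going from $aub$ to $avb$ (and $(a,v\to u,b)$ is the same edge with opposite orientation); and whose $n$-cubes are similarly $(a_1,u_1\to v_1,\dots,a_n,u_n\to v_n,a_{n+1})$, spanned by the vertices $a_1w_1\cdots a_nw_na_{n+1}$ with $w_i\in\{u_i,v_i\}$. $S(\mathcal{P},w_0)$ is the connected component containing $w_0$; it is a nonpositively curved cube complex. In a nonpositively curved cube complex, a hyperplane is an equivalence class of edges for the equivalence relation generated by: two edges are equivalent if they are parallel sides of some square. Oriented hyperplanes are defined likewise with oriented edges; $\vec J$ denotes an orientation of $J$ and $-\vec J$ the opposite one; the edges in the class $J$ are said to be dual to $J$. A hyperplane $J$ is 2-sided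 if $\vec J\neq-\vec J$; self-intersecting if two edges dual to $J$ are non-parallel sides of some square; self-osculating if there are two oriented edges dual to $\vec J$ with the same initial points or the same terminal points but which do not belong to a same square; clean if it is 2-sided and neither self-intersecting nor self-osculating. Two hyperplanes are transverse if there are edges dual to them, respectively, that are non-parallel sides of some square; they are inter-osculating if they are transverse and there are two edges dual to them, respectively, with a common endpoint but which do not belong to a same square. A nonpositively curved cube complex is special if its hyperplanes are clean and it contains no inter-osculating hyperplanes. *)

(* Defs.v *)
From mathcomp Require Import all_boot.
From mathcomp Require Import boolp classical_sets.
From Stdlib Require Import Relation_Operators.

Set Implicit Arguments.
Unset Strict Implicit.
Unset Printing Implicit Defensive.

Local Open Scope classical_set_scope.

(** The 2-skeleton of a cube complex, which is all that hyperplanes and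
    specialness depend on.  Edges are oriented; an unoriented edge is a pair
    [{e, inv e}].  [square e f e' f'] says that some square has the boundary
<<
        x01 --e'-> x11
         ^          ^
         f          f'
         |          |
        x00 --e--> x10
>>
    so that [e], [e'] (resp. [f], [f']) are parallel as oriented edges; a
    geometric square yields the eight such readings of its boundary. *)
Record square_complex := SquareComplex {
  vertexT : Type;
  edgeT : Type;
  vertex : set vertexT;
  edge : set edgeT;
  ini : edgeT -> vertexT;
  ter : edgeT -> vertexT;
  inv : edgeT -> edgeT;
  square : edgeT -> edgeT -> edgeT -> edgeT -> Prop;
  vertex_ini : forall e, edge e -> vertex (ini e);
  edge_inv : forall e, edge e -> edge (inv e);
  ini_inv : forall e, ini (inv e) = ter e;
  invK : involutive inv;
  inv_neq : forall e, edge e -> inv e <> e;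
  square_edge : forall e f e' f', square e f e' f' ->
    [/\ edge e, edge f, edge e' & edge f'];
  square_incidence : forall e f e' f', square e f e' f' ->
    [/\ ini e = ini f, ini f' = ter e, ini e' = ter f & ter e' = ter f'];
  square_swap : forall e f e' f', square e f e' f' -> square f e f' e';
  square_inv : forall e f e' f',
    square e f e' f' -> square (inv e) f' (inv e') f
}.

Section Hyperplanes.
Variable X : square_complex.
Implicit Types (e f : edgeT X) (H J : set (edgeT X)).

Definition parallel e e' := exists f f', square e f e' f'.

(** [e] and [f] issue from the same vertex and span a square there.  Every pair
    of non-parallel sides of a square is of this form, once suitably oriented. *)
Definition span_square e f := exists e' f', square e f e' f'.

Definition oriented_class e : set (edgeT X) :=
  [set f | clos_refl_sym_trans _ parallel e f].

(** A hyperplane is a class of unoriented edges, encoded as a set of oriented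
    edges that is stable under [inv]. *)
Definition unoriented_class e : set (edgeT X) :=
  [set f | clos_refl_sym_trans _ (fun g h => parallel g h \/ h = inv g) e f].

Definition hyperplane J := exists2 e, edge e & J = unoriented_class e.

Definition orientation J H := exists2 e, J e & H = oriented_class e.

Definition opposite H : set (edgeT X) := [set e | H (inv e)].

Definition two_sided J := forall H, orientation J H -> H <> opposite H.

Definition self_intersecting J :=
  exists e f, [/\ J e, J f & span_square e f].

(** Two edges sharing a vertex "do not belong to a same square" when they do
    not span a square at that vertex.  Squares need not be embedded: two sides
    may meet at a corner and also have their other endpoints identified, in
    which case nothing need connect them at the latter vertex.  For instance,
    for the presentation <x, y, v | xv = x, vy = y>, the edges (1, x -> xv, y)
    and (x, y -> vy, 1) span a square at xy and overlap at xvy. *)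
Definition self_osculating J :=
  exists H e f, [/\ orientation J H, H e, H f, e <> f &
    (ini e = ini f /\ ~ span_square e f) \/
    (ter e = ter f /\ ~ span_square (inv e) (inv f))].

Definition clean_hyperplane J :=
  [/\ two_sided J, ~ self_intersecting J & ~ self_osculating J].

Definition transverse J1 J2 :=
  exists e f, [/\ J1 e, J2 f & span_square e f].

(** As hyperplanes are stable under [inv], a common endpoint can be assumed to
    be the common origin. *)
Definition inter_osculating J1 J2 :=
  [/\ J1 <> J2, transverse J1 J2 &
    exists e f, [/\ J1 e, J2 f, ini e = ini f & ~ span_square e f]].

Definition clean := forall J, hyperplane J -> clean_hyperplane J.

Definition no_self_intersection :=
  forall J, hyperplane J -> ~ self_intersecting J.

Definition special :=
  clean /\ forall J1 J2, hyperplane J1 -> hyperplane J2 ->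
             ~ inter_osculating J1 J2.

End Hyperplanes.

Section Component.
Variables (X : square_complex) (x0 : vertexT X).

Definition reachable : set (vertexT X) :=
  [set x | clos_refl_trans _
     (fun y z => exists2 e, edge e & ini e = y /\ ter e = z) x0 x].

Let cvertex : set (vertexT X) := vertex (s := X) `&` reachable.
Let cedge : set (edgeT X) := [set e | edge e /\ reachable (ini e)].
Let csquare (e f e' f' : edgeT X) := square e f e' f' /\ reachable (ini e).

Lemma reachable_ter e : edge e -> reachable (ini e) -> reachable (ter e).
Proof.
move=> ee re; apply: rt_trans re _; apply: rt_step.
by exists e.
Qed.

Fact component_vertex_ini e : cedge e -> cvertex (ini e).
Proof. by case=> ee re; split=> //; apply: vertex_ini. Qed.

Fact component_edge_inv e : cedge e -> cedge (inv e).
Proof.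
case=> ee re; split; first exact: edge_inv.
by rewrite ini_inv; apply: reachable_ter.
Qed.

Fact component_inv_neq e : cedge e -> inv e <> e.
Proof. by case=> ee _; apply: inv_neq. Qed.

Fact component_square_edge e f e' f' : csquare e f e' f' ->
  [/\ cedge e, cedge f, cedge e' & cedge f'].
Proof.
case=> sq re; have [ee ef ee' ef'] := square_edge sq.
have [i1 i2 i3 _] := square_incidence sq.
by split; split=> //; rewrite ?i2 ?i3 -?i1 //; apply: reachable_ter;
  rewrite -?i1.
Qed.

Fact component_square_incidence e f e' f' : csquare e f e' f' ->
  [/\ ini e = ini f, ini f' = ter e, ini e' = ter f & ter e' = ter f'].
Proof. by case=> sq _; apply: square_incidence. Qed.

Fact component_square_swap e f e' f' : csquare e f e' f' -> csquare f e f' e'.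
Proof.
case=> sq re; split; first exact: square_swap.
by have [<-] := square_incidence sq.
Qed.

Fact component_square_inv e f e' f' :
  csquare e f e' f' -> csquare (inv e) f' (inv e') f.
Proof.
case=> sq re; split; first exact: square_inv.
by rewrite ini_inv; apply: reachable_ter => //; have [] := square_edge sq.
Qed.

Definition component := @SquareComplex _ _ cvertex cedge
  (@ini X) (@ter X) (@inv X) csquare
  component_vertex_ini component_edge_inv (@ini_inv X) (@invK X)
  component_inv_neq component_square_edge component_square_incidence
  component_square_swap component_square_inv.

End Component.

Definition word (Sigma : Type) := seq Sigma.

Record presentation (Sigma : Type) := Presentation {
  relator : word Sigma -> word Sigma -> Prop;
  relator_neq1 : forall u v, relator u v -> u <> [::] /\ v <> [::];
  relator_asym : forall u v, relator u v -> ~ relator v u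
}.

Section Squier.
Variables (Sigma : Type) (P : presentation Sigma).
Implicit Types a b u v w p q : word Sigma.

Definition rule u v := relator P u v \/ relator P v u.

Definition rewrite_step w w' :=
  exists a u v b, [/\ rule u v, w = a ++ u ++ b & w' = a ++ v ++ b].

Definition eqmod w w' := clos_refl_trans _ rewrite_step w w'.

Definition eqmod_class w : set (word Sigma) := [set w' | eqmod w w'].

(** [SquierEdge a u v b] is the oriented edge (a, u -> v, b). *)
Record squier_edgeT := SquierEdge {
  prefix_of : word Sigma;
  source_of : word Sigma;
  target_of : word Sigma;
  suffix_of : word Sigma
}.

Definition squier_edge : set squier_edgeT :=
  [set e | rule (source_of e) (target_of e)].

Definition squier_ini (e : squier_edgeT) :=
  prefix_of e ++ source_of e ++ suffix_of e.

Definition squier_ter (e : squier_edgeT) :=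
  prefix_of e ++ target_of e ++ suffix_of e.

Definition squier_inv (e : squier_edgeT) :=
  SquierEdge (prefix_of e) (target_of e) (source_of e) (suffix_of e).

(** The boundary of the square (a1, u1 -> v1, a2, u2 -> v2, a3). *)
Definition squier_cell (e f e' f' : squier_edgeT) :=
  exists a1 u1 v1 a2 u2 v2 a3,
    [/\ rule u1 v1, rule u2 v2,
        e = SquierEdge a1 u1 v1 (a2 ++ u2 ++ a3) /\
        e' = SquierEdge a1 u1 v1 (a2 ++ v2 ++ a3) &
        f = SquierEdge (a1 ++ u1 ++ a2) u2 v2 a3 /\
        f' = SquierEdge (a1 ++ v1 ++ a2) u2 v2 a3].

Definition squier_square (e f e' f' : squier_edgeT) :=
  squier_cell e f e' f' \/ squier_cell f e f' e'.

Fact rule_sym u v : rule u v -> rule v u.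
Proof. by case; [right | left]. Qed.

Fact squier_vertex_ini e :
  squier_edge e -> (setT : set (word Sigma)) (squier_ini e).
Proof. by []. Qed.

Fact squier_edge_inv e : squier_edge e -> squier_edge (squier_inv e).
Proof. exact: rule_sym. Qed.

Fact squier_ini_inv e : squier_ini (squier_inv e) = squier_ter e.
Proof. by []. Qed.

Fact squier_invK : involutive squier_inv.
Proof. by case. Qed.

Fact squier_inv_neq e : squier_edge e -> squier_inv e <> e.
Proof.
case: e => a u v b; rewrite /squier_edge /= => r [vu _].
by move: r; rewrite vu; case=> r; apply: (relator_asym r r).
Qed.

Fact squier_square_edge e f e' f' : squier_square e f e' f' ->
  [/\ squier_edge e, squier_edge f, squier_edge e' & squier_edge f'].
Proof.
by case=> -[a1 [u1 [v1 [a2 [u2 [v2 [a3 [r1 r2 [-> ->] [-> ->]]]]]]]]].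
Qed.

Fact squier_square_incidence e f e' f' : squier_square e f e' f' ->
  [/\ squier_ini e = squier_ini f, squier_ini f' = squier_ter e,
      squier_ini e' = squier_ter f & squier_ter e' = squier_ter f'].
Proof.
by case=> -[a1 [u1 [v1 [a2 [u2 [v2 [a3 [r1 r2 [-> ->] [-> ->]]]]]]]]];
  rewrite /squier_ini /squier_ter /= -!catA.
Qed.

Fact squier_square_swap e f e' f' :
  squier_square e f e' f' -> squier_square f e f' e'.
Proof. by case; [right | left]. Qed.

Fact squier_square_inv e f e' f' :
  squier_square e f e' f' ->
  squier_square (squier_inv e) f' (squier_inv e') f.
Proof.
case=> -[a1 [u1 [v1 [a2 [u2 [v2 [a3 [r1 r2 [-> ->] [-> ->]]]]]]]]].
  by left; exists a1, v1, u1, a2, u2, v2, a3; split=> //; apply: rule_sym.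
by right; exists a1, u1, v1, a2, v2, u2, a3; split=> //; apply: rule_sym.
Qed.

Definition squier_full := @SquareComplex _ _ setT squier_edge
  squier_ini squier_ter squier_inv squier_square
  squier_vertex_ini squier_edge_inv squier_ini_inv squier_invK squier_inv_neq
  squier_square_edge squier_square_incidence
  squier_square_swap squier_square_inv.

Definition squier (w0 : word Sigma) : square_complex :=
  component (X := squier_full) w0.

End Squier.

(* Main.v *)
(** The oriented hyperplane dual to an edge (a, u -> v, b) is determined by the
    rule u -> v and the classes of a and b modulo P, so every configuration of
    hyperplanes amounts to two rule applications and some congruences.  Two
    disjoint applications dual to one hyperplane give prefixes a and a u m that
    are equal modulo P, hence a word p = u m absorbed on both sides; conversely,
    if a = a p and b = p b, rewriting inside either copy of p in a p p b gives
    the same hyperplane.  When two applications of the same oriented rule overlap,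
    u c' = c u, so that a large power of the absorbed word c contains u: a
    self-osculation therefore also violates (iii).  Finally, if two transverse
    hyperplanes osculate at a vertex, comparing the order of the rules in the
    square with their order in the overlap yields a configuration excluded by
    (iv) if the orders agree and the overlap is proper, and again an absorbed
    word otherwise. *)

Require Import Defs.
From mathcomp Require Import all_boot.
From mathcomp Require Import boolp classical_sets.
From Stdlib Require Import Relation_Operators Operators_Properties.
From Stdlib Require Import Setoid Morphisms.

Set Implicit Arguments.
Unset Strict Implicit.
Unset Printing Implicit Defensive.

Local Open Scope classical_set_scope.

(** * Words: overlapping occurrences, powers and conjugation *)

Section Words.
Variable T : Type.
Implicit Types a b c d u v w x y : seq T.

Lemma cat_eq_split a b c d : a ++ b = c ++ d -> size a <= size c ->
  exists2 u, c = a ++ u & b = u ++ d.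
Proof.
elim: a c => [|t a IH] [|t' c] //=; first by move=> ->; exists [::].
  by move=> ->; exists (t' :: c).
by case=> -> /IH{}IH /IH[u -> ->]; exists u.
Qed.

Lemma cat_nil a b : a ++ b = [::] -> a = [::] /\ b = [::].
Proof. by case: a => //; case: b. Qed.

(** The two occurrences are disjoint, nested or properly overlapping. Adjacent factors count as
    disjoint and a common right end as nested, so that in the last case [v] and [w] are non-empty,
    as (iv) demands. *)
Lemma occurrence_overlap a x b c y d :
  a ++ x ++ b = c ++ y ++ d -> size a <= size c ->
  (exists2 m, c = a ++ x ++ m & b = m ++ y ++ d) \/
  exists u v, [/\ c = a ++ u, x = u ++ v, v <> [::] &
    (exists2 w, v = y ++ w & d = w ++ b) \/
    (exists w, [/\ w <> [::], y = v ++ w & b = w ++ d])].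
Proof.
move=> eq /(cat_eq_split eq)[u -> {}eq].
have [xu|/ltnW ux] := leqP (size x) (size u).
  by left; have [m -> ->] := cat_eq_split eq xu; exists m.
have [v xE vb] := cat_eq_split (esym eq) ux.
have [v0|v_neq0] := pselect (v = [::]).
  left; exists [::]; first by rewrite xE v0 !cats0.
  by rewrite vb v0.
right; exists u, v; split=> //.
have [yv|/ltnW vy] := leqP (size y) (size v).
  by left; have [w -> ->] := cat_eq_split vb yv; exists w.
have [w yE bE] := cat_eq_split (esym vb) vy.
have [w0|w_neq0] := pselect (w = [::]).
  left; exists [::]; first by rewrite yE w0 !cats0.
  by rewrite bE w0.
by right; exists w.
Qed.

Lemma cat_cancel a b u v : a ++ u ++ b = a ++ v ++ b -> u = v.
Proof.
move/(congr1 (drop (size a))); rewrite !drop_size_cat // => E.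
have sz : size u = size v.
  by move/(congr1 size): E; rewrite !size_cat => /addIn.
by move/(congr1 (take (size u))): E; rewrite take_size_cat // sz take_size_cat.
Qed.

Definition word_pow c k := iter k (cat c) [::].

Lemma size_word_pow c k : c <> [::] -> k <= size (word_pow c k).
Proof.
move=> c0; elim: k => // k IH; rewrite /= size_cat.
by case: c c0 IH => //= t c _ IH; rewrite addSn ltnS (leq_trans IH) ?leq_addl.
Qed.

Lemma word_pow_conj c u w k :
  c ++ u = u ++ w -> word_pow c k ++ u = u ++ word_pow w k.
Proof.
move=> cu; elim: k => [|k IH] /=; first by rewrite cats0.
by rewrite -catA IH !catA cu.
Qed.

End Words.

Section SquierHyperplanes.
Variables (Sigma : Type) (P : presentation Sigma).
Implicit Types a b c d m p q u v w x y : word Sigma.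

(** * The congruence defined by the presentation *)

Lemma rewrite_step_sym w w' : rewrite_step P w w' -> rewrite_step P w' w.
Proof.
case=> a [u [v [b [r -> ->]]]]; exists a, v, u, b; split=> //.
exact: rule_sym.
Qed.

Lemma eqmod_refl w : eqmod P w w.
Proof. exact: rt_refl. Qed.

#[local] Hint Resolve eqmod_refl : core.

Lemma eqmod_trans w1 w2 w3 : eqmod P w1 w2 -> eqmod P w2 w3 -> eqmod P w1 w3.
Proof. exact: rt_trans. Qed.

Lemma eqmod_sym w1 w2 : eqmod P w1 w2 -> eqmod P w2 w1.
Proof.
elim=> {w1 w2} [w1 w2 /rewrite_step_sym st|w|w1 w2 w3 _ IH1 _ IH2].
- exact: rt_step.
- exact: eqmod_refl.
- exact: eqmod_trans IH2 IH1.
Qed.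

#[local] Instance eqmod_equivalence : Equivalence (eqmod P).
Proof.
split; [exact: eqmod_refl | exact: eqmod_sym | exact: eqmod_trans].
Qed.

Lemma eqmod_cat2l a w w' : eqmod P w w' -> eqmod P (a ++ w) (a ++ w').
Proof.
elim=> {w w'} [w w' [c [u [v [d [r -> ->]]]]]|w|w1 w2 w3 _ IH1 _ IH2].
- by apply: rt_step; exists (a ++ c), u, v, d; rewrite !catA.
- exact: eqmod_refl.
- exact: eqmod_trans IH1 IH2.
Qed.

Lemma eqmod_cat2r b w w' : eqmod P w w' -> eqmod P (w ++ b) (w' ++ b).
Proof.
elim=> {w w'} [w w' [c [u [v [d [r -> ->]]]]]|w|w1 w2 w3 _ IH1 _ IH2].
- by apply: rt_step; exists c, u, v, (d ++ b); rewrite -!catA.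
- exact: eqmod_refl.
- exact: eqmod_trans IH1 IH2.
Qed.

#[local] Instance eqmod_cat_proper :
  Proper (eqmod P ==> eqmod P ==> eqmod P) (@cat Sigma).
Proof.
move=> a a' aa' b b' bb'.
exact: eqmod_trans (eqmod_cat2r _ aa') (eqmod_cat2l _ bb').
Qed.

Lemma rule_eqmod u v : rule P u v -> eqmod P u v.
Proof. by move=> r; apply: rt_step; exists [::], u, v, [::]; rewrite !cats0. Qed.

Lemma rule_neq0 u v : rule P u v -> u <> [::] /\ v <> [::].
Proof. by case=> /relator_neq1[]. Qed.

Lemma rule_neq u v : rule P u v -> u <> v.
Proof.
by move=> r uv; move: r; rewrite uv; case=> r; apply: (relator_asym r r).
Qed.

Lemma eqmod_nil w w' : eqmod P w w' -> w = [::] <-> w' = [::].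
Proof.
elim=> {w w'} [w w' [c [u [v [d [r -> ->]]]]]|//|w1 w2 w3 _ -> _ -> //].
have [u0 v0] := rule_neq0 r.
by split=> /cat_nil[_ /cat_nil[]].
Qed.

Lemma eqmod_class_not_singleton p :
  eqmod_class P p <> [set p] <->
  exists c u v d, rule P u v /\ p = c ++ u ++ d.
Proof.
split=> [neq|[c [u [v [d [r ->]]]]] eq].
  apply: contrapT => none; apply: neq; apply/seteqP; split=> [w|w ->]; last first.
    exact: eqmod_refl.
  (* A derivation leaving [p] has a first step, which exhibits a relator inside [p]. *)
  move=> /clos_rt_rt1n_iff; case=> // w1 w2 [c [u [v [d [r pE _]]]]].
  by case: none; exists c, u, v, d.
have : eqmod_class P (c ++ u ++ d) (c ++ v ++ d).
  by apply: rt_step; exists c, u, v, d.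
rewrite eq => /= E; apply: (rule_neq r).
exact: cat_cancel (esym E).
Qed.

(** * Hyperplanes described by a rule and two congruence classes *)

Variable w0 : word Sigma.
Local Notation S := (squier P w0).
Implicit Types (e f g : squier_edgeT Sigma) (J : set (edgeT S)).

Lemma squier_reachable w :
  reachable (X := squier_full P) w0 w <-> eqmod P w0 w.
Proof.
split; elim=> {w} [w w' st|w|w1 w2 w3 _ IH1 _ IH2];
  try exact: rt_refl; try exact: rt_trans IH1 IH2; apply: rt_step.
- case: st => -[a u v b] /= r [<- <-]; by exists a, u, v, b.
- case: st => a [u [v [b [r -> ->]]]]; by exists (SquierEdge a u v b).
Qed.

Lemma squier_edgeE e : edge (s := S) e <->
  rule P (source_of e) (target_of e) /\
  eqmod P w0 (prefix_of e ++ source_of e ++ suffix_of e).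
Proof. by split=> -[r /squier_reachable]. Qed.

Definition same_hyperplane e f :=
  [/\ eqmod P (prefix_of e) (prefix_of f),
      eqmod P (suffix_of e) (suffix_of f) &
      (source_of e = source_of f /\ target_of e = target_of f) \/
      (source_of e = target_of f /\ target_of e = source_of f)].

Definition same_oriented e f :=
  [/\ eqmod P (prefix_of e) (prefix_of f),
      eqmod P (suffix_of e) (suffix_of f),
      source_of e = source_of f & target_of e = target_of f].

(** The two equations force a common origin, in which the two sources are disjoint factors separated
    by [m]. *)
Definition left_of e f := exists2 m,
  prefix_of f = prefix_of e ++ source_of e ++ m &
  suffix_of e = m ++ source_of f ++ suffix_of f.

Lemma same_hyperplane_sym e f : same_hyperplane e f -> same_hyperplane f e.
Proof.
by case=> pr su [[s t]|[s t]]; split; try exact: eqmod_sym; [left|right].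
Qed.

Lemma same_hyperplane_trans e f g :
  same_hyperplane e f -> same_hyperplane f g -> same_hyperplane e g.
Proof.
case=> p1 s1 o1 [p2 s2 o2]; split; [exact: eqmod_trans p2|exact: eqmod_trans s2|].
by case: o1 o2 => -[-> ->] [[-> ->]|[-> ->]]; [left|right|right|left].
Qed.

Lemma rule_eqmod1 u v a b : rule P u v -> eqmod P (a ++ u ++ b) (a ++ v ++ b).
Proof. by move/rule_eqmod => r; apply/eqmod_cat2l/eqmod_cat2r. Qed.

Lemma parallel_same_oriented e f :
  parallel (X := S) e f -> same_oriented e f.
Proof.
case=> g [h [sq _]].
case: sq => -[a1 [u1 [v1 [a2 [u2 [v2 [a3 [r1 r2 [E1 E2] [E3 E4]]]]]]]]].
  by rewrite E1 E2; split=> //=; exact: rule_eqmod1.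
by rewrite E3 E4; split=> //=; exact: rule_eqmod1.
Qed.

Lemma oriented_same e f : oriented_class (X := S) e f -> same_oriented e f.
Proof.
elim=> {e f} [e f|e|e f _ [p s st tt]|
              e f g _ [p1 s1 st1 tt1] _ [p2 s2 st2 tt2]].
- exact: parallel_same_oriented.
- by [].
- by split=> //; exact: eqmod_sym.
- split; [exact: eqmod_trans p2|exact: eqmod_trans s2| |].
    by rewrite st1.
  by rewrite tt1.
Qed.

(** Every elementary rewriting of the suffix or of the prefix spans a square with the edge. A
    derivation is thus a chain of squares: the suffix is changed first, then the prefix. The
    induction carries the congruence of the origin with [w0], which keeps these squares in the
    component. *)
Lemma same_oriented_class e f : edge (s := S) e -> same_oriented e f ->
  oriented_class (X := S) e f.
Proof.
case: e f => a u v b [a' u' v' b'] /squier_edgeE[/= r re] [/= aa' bb' <- <-].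
apply: (@rst_trans _ _ _ (SquierEdge a u v b')).
- move: bb' re => /clos_rt_rt1n_iff; elim=> {b b'} [b _|b b1 b2 st _ IH re].
    exact: rst_refl.
  have [c [s [t [d [r' bE b1E]]]]] := st.
  apply: (@rst_trans _ _ _ (SquierEdge a u v b1)).
    apply: rst_step; exists (SquierEdge (a ++ u ++ c) s t d).
    exists (SquierEdge (a ++ v ++ c) s t d).
    split; last exact/squier_reachable.
    by left; exists a, u, v, c, s, t, d; rewrite bE b1E.
  apply: IH; apply: eqmod_trans re _; rewrite /squier_ini /=.
  by do 2!apply: eqmod_cat2l; exact: rt_step.
- have {bb' b}re : eqmod P w0 (squier_ini (SquierEdge a u v b')).
    by apply: eqmod_trans re _; do 2!apply: eqmod_cat2l.
  move: aa' re => /clos_rt_rt1n_iff; elim=> {a a'} [a _|a a1 a2 st _ IH re].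
    exact: rst_refl.
  have [c [s [t [d [r' aE a1E]]]]] := st.
  apply: (@rst_trans _ _ _ (SquierEdge a1 u v b')).
    apply: rst_step; exists (SquierEdge c s t (d ++ u ++ b')).
    exists (SquierEdge c s t (d ++ v ++ b')).
    split; last exact/squier_reachable.
    by right; exists c, s, t, d, u, v, b'; rewrite aE a1E.
  apply: IH; apply: eqmod_trans re _; rewrite /squier_ini /=.
  by apply: eqmod_cat2r; exact: rt_step.
Qed.

Lemma unoriented_same e f : unoriented_class (X := S) e f -> same_hyperplane e f.
Proof.
elim=> {e f} [e f [/parallel_same_oriented[p s st tt]|->]|e|e f _|
              e f g _ IH1 _ IH2].
- by split=> //; left.
- by split=> //; right.
- by split=> //; left.
- exact: same_hyperplane_sym.
- exact: same_hyperplane_trans IH1 IH2.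
Qed.

Lemma unoriented_edge (X : square_complex) (e f : edgeT X) :
  unoriented_class e f -> edge e <-> edge f.
Proof.
elim=> {e f} [e f [[g [h /square_edge[]]]|->]|//|e f _ -> //|e f g _ -> _ -> //].
  by [].
by split=> [|/edge_inv]; [exact: edge_inv|rewrite invK].
Qed.

Lemma oriented_unoriented (X : square_complex) (e f : edgeT X) :
  oriented_class e f -> unoriented_class e f.
Proof.
elim=> {e f} [e f|e|e f _|e f g _ IH1 _ IH2].
- by move=> pa; apply: rst_step; left.
- exact: rst_refl.
- exact: rst_sym.
- exact: rst_trans IH1 IH2.
Qed.

Lemma same_hyperplane_class e f : edge (s := S) e -> same_hyperplane e f ->
  unoriented_class (X := S) e f.
Proof.
move=> ee [p s [[st tt]|[st tt]]].
  by apply: oriented_unoriented; apply: same_oriented_class.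
have eef : oriented_class (X := S) e (squier_inv f) by apply: same_oriented_class.
apply: rst_trans (oriented_unoriented eef) _.
by apply: rst_step; right; rewrite /= squier_invK.
Qed.

(** From here on, duality to a common hyperplane is handled through congruences only. *)
Lemma in_hyperplane J e f : hyperplane J -> J e -> J f <->
  edge (s := S) f /\ same_hyperplane e f.
Proof.
case=> e0 ee0 -> /= e0e; have ee := (unoriented_edge e0e).1 ee0.
split=> [e0f|[_ ef]].
  split; first exact: (unoriented_edge e0f).1.
  apply: same_hyperplane_trans (unoriented_same e0f).
  exact/same_hyperplane_sym/unoriented_same.
by apply: rst_trans e0e _; exact: same_hyperplane_class.
Qed.

Lemma span_squareE e f : edge (s := S) e -> edge (s := S) f ->
  span_square (X := S) e f <-> left_of e f \/ left_of f e.
Proof.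
case: e f => [a u v b] [c s t d] /squier_edgeE[/= r re] /squier_edgeE[/= r' re'].
split=> [[g [h [sq _]]]|].
  case: sq => -[a1 [u1 [v1 [a2 [u2 [v2 [a3 [r1 r2 [E1 E2] [E3 E4]]]]]]]]].
    by left; exists a2; move: E1 E3 => [-> -> _ ->] [-> -> _ ->].
  by right; exists a2; move: E1 E3 => [-> -> _ ->] [-> -> _ ->].
case=> -[m] /= pE sE.
  exists (SquierEdge a u v (m ++ t ++ d)), (SquierEdge (a ++ v ++ m) s t d).
  split; last exact/squier_reachable.
  by left; exists a, u, v, m, s, t, d; rewrite pE sE.
exists (SquierEdge (c ++ t ++ m) u v b), (SquierEdge c s t (m ++ v ++ b)).
split; last exact/squier_reachable.
by right; exists c, s, t, m, u, v, b; rewrite pE sE.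
Qed.

(** * Absorbed words, the configurations that (iii) forbids *)

Definition absorbing := exists a b p : word Sigma,
  [/\ [/\ a <> [::], b <> [::] & p <> [::]],
      eqmod P w0 (a ++ b), eqmod P a (a ++ p), eqmod P b (p ++ b) &
      eqmod_class P p <> [set p]].

(** The non-emptiness conditions come for free: [p] contains a side of a relation, and only the
    empty word is congruent to the empty word. *)
Lemma absorbing_intro a b p c s t d : rule P s t -> p = c ++ s ++ d ->
  eqmod P w0 (a ++ b) -> eqmod P a (a ++ p) -> eqmod P b (p ++ b) -> absorbing.
Proof.
move=> r pE w0E aE bE; exists a, b, p.
have p0 : p <> [::].
  by rewrite pE => /cat_nil[_ /cat_nil[s0]]; case: (rule_neq0 r).
split=> //; last by apply/eqmod_class_not_singleton; exists c, s, t, d.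
split=> // [a0|b0].
  by apply: p0; have [] := cat_nil ((eqmod_nil aE).1 a0).
by apply: p0; have [] := cat_nil ((eqmod_nil bE).1 b0).
Qed.

Lemma left_of_absorbing e f : edge (s := S) e -> edge (s := S) f ->
  same_hyperplane e f -> left_of e f -> absorbing.
Proof.
case: e f => [a u v b] [a' u' v' b'] /squier_edgeE[/= r re] /squier_edgeE[/= r' re'].
rewrite /same_hyperplane /left_of /= => -[aa' bb' uu'] [m a'E bE].
(* The two edges may carry the rule in opposite directions, but their sources are congruent
   anyway. *)
have {uu' v' r' re'}uu' : eqmod P u u'.
  case: uu' => -[-> _] => //.
  exact/eqmod_sym/rule_eqmod.
(* The right factor absorbs [u ++ m] because, modulo the presentation, u b' = u b = u m u' b' = u m
   u b'. *)
apply: (@absorbing_intro a (u ++ b') (u ++ m) [::] u v m) => //.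
- by rewrite re bb'.
- by rewrite -a'E.
- rewrite -catA; apply: eqmod_cat2l.
  by rewrite uu' -bE bb'.
Qed.

(** The word [u] itself may contain no relator, so a power of it is absorbed instead. Conjugation by
    [s] turns powers of [u] into powers of [v], which [b] absorbs. *)
Lemma overlap_absorbing a b u v s t : rule P s t ->
  eqmod P w0 (a ++ s ++ v ++ b) -> u ++ s = s ++ v -> u <> [::] ->
  eqmod P a (a ++ u) -> eqmod P b (v ++ b) -> absorbing.
Proof.
move=> r w0E us u0 aE bE.
have aEk k : eqmod P a (a ++ word_pow u k).
  by elim: k => [|k IH] /=; rewrite ?cats0 // catA -aE.
have bEk k : eqmod P b (word_pow v k ++ b).
  by elim: k => [|k IH] //=; rewrite -catA -IH.
(* As [u] is non-empty, its power of exponent [size s] is long enough to have [s] as a prefix. *)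
have [d dE _] :=
  cat_eq_split (esym (word_pow_conj (size s) us)) (size_word_pow _ u0).
apply: (@absorbing_intro a (s ++ b) (word_pow u (size s)) [::] s t d) => //.
- by rewrite w0E -bE.
- by rewrite catA (word_pow_conj _ us) -catA -bEk.
Qed.

(** Both edges have the same source, so distinct edges cannot be nested, and without a square they
    are not disjoint either. The sources therefore overlap properly, and the shift [x] of one
    against the other satisfies x u = u z. *)
Lemma osculating_absorbing e f : edge (s := S) e -> edge (s := S) f ->
  same_oriented e f -> squier_ini e = squier_ini f -> e <> f ->
  ~ span_square (X := S) e f -> absorbing.
Proof.
wlog le : e f / size (prefix_of e) <= size (prefix_of f) => [hw|].
  move=> ee ef [p s st tt] ie nef nsq.
  have [|/ltnW] := leqP (size (prefix_of e)) (size (prefix_of f)).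
    by move/hw; apply.
  move/hw; apply=> //; first by split=> //; exact: eqmod_sym.
    by move=> fe; apply: nef.
  by move=> /(span_squareE ef ee)/or_comm/(span_squareE ee ef).
move=> ee ef so ie nef /(span_squareE ee ef) nsq.
case: e f ee ef le so ie nef nsq => [a u v b] [c s t d].
rewrite /same_oriented /left_of /squier_ini /=.
move=> /squier_edgeE[/= r re] _ le [ac bd <- <-] eq nef nsq {s t}.
case: (occurrence_overlap eq le) => [[m cE bE]|].
  by case: nsq; left; exists m.
move=> [x [y [cE uE y0 yu]]].
have x0 : x <> [::].
  move=> x0; apply: nef; move: eq; rewrite cE x0 cats0.
  by move/(congr1 (drop (size (a ++ u)))); rewrite !catA !drop_size_cat // => ->.
have [z uE' bE] : exists2 z, u = y ++ z & b = z ++ d.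
  case: yu => [[w yE _]|[z [_ uE' bE]]]; last by exists z.
  case: x0; move/(congr1 size): uE; rewrite yE !size_cat addnCA.
  by rewrite -[LHS]addn0 => /addnI/esym/eqP; rewrite addn_eq0 => /andP[/nilP].
apply: (@overlap_absorbing a d x z u v) => //.
- by rewrite -bE.
- by rewrite {1}uE' catA -uE.
- by rewrite -cE.
- by rewrite -bE; exact: eqmod_sym.
Qed.

(** The source is constant on an oriented class, and reversing an edge replaces it with the target,
    which is a different word. *)
Lemma two_sided_squier J : hyperplane J -> two_sided J.
Proof.
move=> hJ H [e Je ->] eqop.
have [/squier_edgeE[r _] _] := (in_hyperplane _ hJ Je).1 Je.
have : opposite (X := S) (oriented_class (X := S) e) e.
  by rewrite -eqop; exact: rst_refl.
by move=> /oriented_same[_ _ st _]; case: (rule_neq r).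
Qed.

Lemma self_intersecting_absorbing J :
  hyperplane J -> self_intersecting J -> absorbing.
Proof.
move=> hJ [e [f [Je Jf]]].
have [ee _] := (in_hyperplane _ hJ Je).1 Je.
have [ef sh] := (in_hyperplane _ hJ Je).1 Jf.
case/(span_squareE ee ef); first exact: left_of_absorbing.
by apply: left_of_absorbing => //; exact: same_hyperplane_sym.
Qed.

Lemma absorbing_self_intersecting :
  absorbing -> exists2 J, hyperplane J & self_intersecting (X := S) J.
Proof.
move=> [a [b [p [_ w0E aE bE /eqmod_class_not_singleton[c [u [v [d [r pE]]]]]]]]].
(* The same relator is rewritten in the first copy of [p] in a p p b for [e], and in the second copy
   for [f]. *)
pose e := SquierEdge (a ++ c) u v (d ++ p ++ b).
pose f := SquierEdge (a ++ p ++ c) u v (d ++ b).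
have w0E' : eqmod P w0 (a ++ p ++ p ++ b) by rewrite -!bE.
have ee : edge (s := S) e.
  apply/squier_edgeE; split=> //=.
  suff -> : (a ++ c) ++ u ++ d ++ p ++ b = a ++ p ++ p ++ b by [].
  by rewrite [X in _ = a ++ X ++ _]pE -!catA.
have ef : edge (s := S) f.
  apply/squier_edgeE; split=> //=.
  suff -> : (a ++ p ++ c) ++ u ++ d ++ b = a ++ p ++ p ++ b by [].
  by rewrite [X in _ = a ++ p ++ X ++ _]pE -!catA.
have sef : same_hyperplane e f.
  by split; [rewrite /= catA -aE|rewrite /= -bE|left].
exists (unoriented_class (X := S) e); first by exists e.
exists e, f; split; [exact: rst_refl|exact: same_hyperplane_class|].
apply/span_squareE => //; left; exists (d ++ c) => /=.
  by rewrite [X in a ++ X ++ _]pE -!catA.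
by rewrite [X in _ ++ X ++ _]pE -!catA.
Qed.

Lemma self_osculating_absorbing J :
  hyperplane J -> self_osculating J -> absorbing.
Proof.
move=> hJ [H [e [f [[g Jg ->] ge gf ef osc]]]].
have [eg _] := (in_hyperplane _ hJ Jg).1 Jg.
have edge_of h : oriented_class (X := S) g h -> edge (s := S) h.
  by move=> /oriented_unoriented/unoriented_edge <-.
have [[p1 s1 st1 tt1] [p2 s2 st2 tt2]] := (oriented_same ge, oriented_same gf).
have so : same_oriented e f.
  split; [exact: eqmod_trans (eqmod_sym p1) p2|
          exact: eqmod_trans (eqmod_sym s1) s2| |].
    by rewrite -st1.
  by rewrite -tt1.
have [ee edf] := (edge_of _ ge, edge_of _ gf).
case: osc => -[ie nsq]; first exact: (osculating_absorbing ee edf so).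
have [p s st tt] := so.
(* A common terminal point becomes a common origin once both edges are reversed. *)
apply: (@osculating_absorbing (squier_inv e) (squier_inv f)) => //.
- exact: (edge_inv (s := S)).
- exact: (edge_inv (s := S)).
- by move=> /(congr1 (@squier_inv _)); rewrite !squier_invK.
Qed.

(** * Inter-osculation and condition (iv) *)

(* [e] is to the left of [f] in some square, up to replacing both edges with
   edges dual to the same hyperplanes. *)
Definition left_mod e f := exists2 m,
  eqmod P (prefix_of f) (prefix_of e ++ source_of e ++ m) &
  eqmod P (suffix_of e) (m ++ source_of f ++ suffix_of f).

Lemma same_hyperplane_source e f : edge (s := S) e ->
  same_hyperplane e f -> eqmod P (source_of e) (source_of f).
Proof.
case/squier_edgeE => r _ [_ _ [[-> _]|[_ <-]]] => //.
exact: rule_eqmod.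
Qed.

Lemma left_of_left_mod e0 f0 e f : edge (s := S) e0 -> edge (s := S) f0 ->
  same_hyperplane e0 e -> same_hyperplane f0 f -> left_of e0 f0 -> left_mod e f.
Proof.
move=> ee0 ef0 se sf [m pE sE].
have ue := same_hyperplane_source ee0 se; have uf := same_hyperplane_source ef0 sf.
case: se sf => [pe se _] [pf sf _]; exists m.
  by rewrite -pf pE pe ue.
by rewrite -se sE uf sf.
Qed.

(** Cut the common origin just before the source of the edge that is on the right in the square. The
    stretch from there to the end of the other source, followed by the gap [m], is absorbed on both
    sides. Nesting puts the source of [f] inside this stretch. *)
Lemma nested_absorbing e f u w : edge (s := S) e -> edge (s := S) f ->
  prefix_of f = prefix_of e ++ u -> source_of e = u ++ source_of f ++ w ->
  suffix_of f = w ++ suffix_of e -> left_mod e f \/ left_mod f e -> absorbing.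
Proof.
case: e f => [a x x' b] [c y y' d] /squier_edgeE[/= rx w0E] /squier_edgeE[/= ry _].
rewrite /left_mod /=.
move=> cE xE dE; rewrite {}cE {}dE {}xE in rx w0E *.
case=> -[m]; rewrite -!catA => aE bE.
  apply: (@absorbing_intro (a ++ u) (y ++ w ++ b) (y ++ w ++ m) [::] y y'
    (w ++ m)) => //.
  - by rewrite w0E -!catA.
  - by rewrite -!catA -aE.
  - by rewrite -!catA -bE.
apply: (@absorbing_intro a (u ++ y ++ w ++ b) (u ++ y ++ m) u y y' m) => //.
- by rewrite w0E -!catA.
- by rewrite -!catA -bE.
Qed.

Definition crossing := exists (u v w p q : word Sigma) (a b xi : word Sigma),
  [/\ [/\ u <> [::], v <> [::], w <> [::], p <> [::] & q <> [::]],
      eqmod P w0 (a ++ u ++ v ++ w ++ b),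
      eqmod P (a ++ u) (a ++ u ++ v ++ xi),
      eqmod P (w ++ b) (xi ++ v ++ w ++ b) &
      rule P (u ++ v) p /\ rule P (v ++ w) q].

(** The cut is the same as for nested sources. If [f] is on the left, the absorbed word u v w m
    contains the relator u v. If [e] is on the left, it is only v m, which need not contain a
    relator: this is the crossing, with [m] as [xi]. *)
Lemma overlapping_crossing e f u v w : edge (s := S) e -> edge (s := S) f ->
  prefix_of f = prefix_of e ++ u -> source_of e = u ++ v ->
  source_of f = v ++ w -> suffix_of e = w ++ suffix_of f ->
  v <> [::] -> w <> [::] -> left_mod e f \/ left_mod f e ->
  absorbing \/ crossing.
Proof.
move=> ee ef cE xE yE bE v0 w_neq0 lm.
(* For empty [u], the source of [e] is a prefix of that of [f]: a nesting with the roles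
   exchanged. *)
have [u0|u0] := pselect (u = [::]).
  left; apply: (@nested_absorbing f e [::] w) => //.
  - by rewrite cE u0 !cats0.
  - by rewrite xE yE u0.
  - exact/or_comm.
case: e f ee ef cE xE yE bE lm => [a x x' b] [c y y' d].
move=> /squier_edgeE[/= rx w0E] /squier_edgeE[/= ry _].
rewrite /left_mod /=.
move=> cE xE yE bE; rewrite {}cE {}xE {}yE {}bE in rx ry w0E *.
case=> -[m]; rewrite -!catA => aE bE.
  right; exists u, v, w, x', y', a, d, m; split=> //.
  - by split=> //; [case: (rule_neq0 rx)|case: (rule_neq0 ry)].
  - by rewrite w0E -!catA.
left; apply: (@absorbing_intro a (u ++ v ++ w ++ d) (u ++ v ++ w ++ m)
  [::] (u ++ v) x' (w ++ m)) => //.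
- by rewrite -!catA.
- by rewrite w0E -!catA.
- by rewrite -!catA -bE.
Qed.

Lemma osculating_crossing e f : edge (s := S) e -> edge (s := S) f ->
  squier_ini e = squier_ini f -> ~ span_square (X := S) e f ->
  left_mod e f \/ left_mod f e -> absorbing \/ crossing.
Proof.
wlog le : e f / size (prefix_of e) <= size (prefix_of f) => [hw|].
  move=> ee ef ie nsq lm.
  have [|/ltnW] := leqP (size (prefix_of e)) (size (prefix_of f)).
    by move/hw; apply.
  move/hw; apply=> //; last exact/or_comm.
  by move=> /(span_squareE ef ee)/or_comm/(span_squareE ee ef).
move=> ee ef ie /(span_squareE ee ef) nsq lm.
case: (occurrence_overlap ie le) => [[m cE bE]|].
  by case: nsq; left; exists m.
move=> [u [v [cE xE v0 [[w vE dE]|[w [w_neq0 yE bE]]]]]].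
  by left; apply: (@nested_absorbing e f u w) => //; rewrite xE vE.
exact: (@overlapping_crossing e f u v w).
Qed.

Lemma inter_osculating_crossing J1 J2 : hyperplane J1 -> hyperplane J2 ->
  inter_osculating (X := S) J1 J2 -> absorbing \/ crossing.
Proof.
move=> h1 h2 [_ [e0 [f0 [Je0 Jf0 sq]]] [e [f [Je Jf ie nsq]]]].
have [ee0 _] := (in_hyperplane _ h1 Je0).1 Je0.
have [ef0 _] := (in_hyperplane _ h2 Jf0).1 Jf0.
have [ee se] := (in_hyperplane _ h1 Je0).1 Je.
have [ef sf] := (in_hyperplane _ h2 Jf0).1 Jf.
apply: (osculating_crossing ee ef ie nsq).
by case/(span_squareE ee0 ef0): sq => lo; [left|right]; apply: left_of_left_mod lo.
Qed.

(** The edges [e] and [f] meet at a u v w b with overlapping sources. Absorbing v xi moves them to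
    [e'] and [f'], dual to the same hyperplanes, whose sources are separated by [xi]. *)
Lemma crossing_inter_osculating : crossing -> no_self_intersection S ->
  exists J1 J2, [/\ hyperplane J1, hyperplane J2 &
    inter_osculating (X := S) J1 J2].
Proof.
move=> [u [v [w [p [q [a [b [xi [[u0 v0 w_neq0 p0 q0] w0E aE bE [r1 r2]]]]]]]]]] nsi.
pose e := SquierEdge a (u ++ v) p (w ++ b).
pose f := SquierEdge (a ++ u) (v ++ w) q b.
pose e' := SquierEdge a (u ++ v) p (xi ++ v ++ w ++ b).
pose f' := SquierEdge (a ++ u ++ v ++ xi) (v ++ w) q b.
have ee : edge (s := S) e
  by apply/squier_edgeE; split; rewrite //= -!catA.
have ef : edge (s := S) f
  by apply/squier_edgeE; split; rewrite //= -!catA.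
have see' : same_hyperplane e e' by split=> //; left.
have sff' : same_hyperplane f f' by split=> //; left.
have Jee' := same_hyperplane_class ee see'.
have Jff' := same_hyperplane_class ef sff'.
have ee' := (unoriented_edge Jee').1 ee; have ef' := (unoriented_edge Jff').1 ef.
have sq : span_square (X := S) e' f'.
  by apply/span_squareE => //; left; exists xi; rewrite /= -!catA.
have h1 : hyperplane (unoriented_class (X := S) e) by exists e.
exists (unoriented_class (X := S) e), (unoriented_class (X := S) f); split=> //.
  by exists f.
split.
(* If the two hyperplanes were equal, the square spanned by [e'] and [f'] would be a
   self-intersection. *)
- by move=> ef12; apply: (nsi _ h1); exists e', f'; split=> //; rewrite ef12.
- by exists e', f'.
- exists e, f; split; [exact: rst_refl|exact: rst_refl| |].
    by rewrite /= /squier_ini /= -!catA.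
  (* Comparing the lengths of the prefixes, a square would force [v] to be empty in one order and
     [u] in the other. *)
  case/span_squareE => // -[m /(congr1 size)/eqP]; rewrite /= !size_cat.
    rewrite eqn_add2l -addnA -[eqbLHS]addn0 eqn_add2l eq_sym addn_eq0.
    by case: (v) v0.
  by rewrite -addnA -[eqbLHS]addn0 eqn_add2l eq_sym addn_eq0; case: (u) u0.
Qed.

End SquierHyperplanes.

Theorem theorem1p2 (Sigma : Type) (P : presentation Sigma) (w0 : word Sigma)
    (w0_neq1 : w0 <> [::]) :
  let S := squier P w0 in
  let cond_i := clean S in
  let cond_ii := no_self_intersection S in
  let cond_iii :=
    ~ (exists a b p : word Sigma,
         [/\ [/\ a <> [::], b <> [::] & p <> [::]],
             eqmod P w0 (a ++ b),
             eqmod P a (a ++ p),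
             eqmod P b (p ++ b) &
             eqmod_class P p <> [set p]]) in
  let cond_iv :=
    ~ (exists (u v w p q : word Sigma) (a b xi : word Sigma),
         [/\ [/\ u <> [::], v <> [::], w <> [::], p <> [::] & q <> [::]],
             eqmod P w0 (a ++ u ++ v ++ w ++ b),
             eqmod P (a ++ u) (a ++ u ++ v ++ xi),
             eqmod P (w ++ b) (xi ++ v ++ w ++ b) &
             rule P (u ++ v) p /\ rule P (v ++ w) q]) in
  [/\ cond_i <-> cond_ii,
      cond_ii <-> cond_iii &
      special S <-> [/\ cond_i, cond_ii, cond_iii & cond_iv]].
Proof.
move=> S cond_i cond_ii cond_iii cond_iv.
(* The implications form a cycle (i), (ii), (iii), (i), so self-osculation only has to be excluded
   in the last one. *)
have i_ii : cond_i -> cond_ii by move=> cl J /cl[].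
have ii_iii : cond_ii -> cond_iii.
  by move=> nsi /absorbing_self_intersecting[J hJ]; exact: nsi.
have iii_i : cond_iii -> cond_i.
  move=> nab J hJ; split.
  - exact: two_sided_squier.
  - by move/(self_intersecting_absorbing hJ).
  - by move/(self_osculating_absorbing hJ).
split; [by split; auto|by split; auto|].
split=> [[ci nio]|[ci _ ciii civ]].
  split; auto => cr.
  by have [J1 [J2 [h1 h2]]] := crossing_inter_osculating cr (i_ii ci); exact: nio.
split=> // J1 J2 h1 h2 io.
by case: (inter_osculating_crossing h1 h2 io) => [/ciii|/civ].
Qed.
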